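(* Let $K=\mathbb{F}_q$ be a finite field, let $S=K[t_1,\ldots,t_s]$, let $\prec$ be a monomial order on $S$, let $X$ be a subset of $\mathbb{A}^s=K^s$, let $I=I(X)$ be the vanishing ideal of $X$, let $\mathcal{L}$ be a $K$-linear subspace of $K\Delta_\prec(I)$, and let $\mathcal{L}_X$ be the standard evaluation code on $X$. Then $$ {\rm fp}_r(\mathcal{L}_X)\leq\delta_r(\mathcal{L}_X)\quad\mbox{for } 1\leq r\leq\dim_K(\mathcal{L}_X). $$
   Context: The vanishing ideal $I(X)$ is the set of all $f\in S$ vanishing at every point of $X$. For a monomial order $\prec$, ${\rm in}_\prec(f)$ is the initial monomial of a nonzero $f\in S$ and ${\rm in}_\prec(I)$ is the initial ideal of $I$. $\Delta_\prec(I)$ is the set of standard monomials of $S/I$, i.e. monomials not in ${\rm in}_\prec(I)$, and $K\Delta_\prec(I)$ is its $K$-span. Write $X=\{P_1,\ldots,P_m\}$ (distinct points). The evaluation map is ${\rm ev}\colon S\to K^m$, $f\mapsto(f(P_1),\ldots,f(P_m))$. For a finite-dimensional $K$-linear subspace $\mathcal{L}\subset S$, the evaluation code $\mathcal{L}_X$ is the image ${\rm ev}(\mathcal{L})$; it is called a standard evaluation code on $X$ relative to $\prec$ if $\mathcal{L}\subset K\Delta_\prec(I(X))$. Let $\mathcal{L}^*=\mathcal{L}\setminus\{0\}$, ${\rm in}_\prec(\mathcal{L}^* )=\{{\rm in}_\prec(f)\mid f\in\mathcal{L}^*\}$, and let $\mathcal{N}_{\prec,r}$ be the family of all subsets $N$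 of ${\rm in}_\prec(\mathcal{L}^* )$ with $r$ distinct elements. The $r$-th footprint of $\mathcal{L}_X$ is $$ {\rm fp}_r(\mathcal{L}_X):=\deg(S/I)-\max\{\deg(S/({\rm in}_\prec(I),N))\mid N\in\mathcal{N}_{\prec,r}\}, $$ where $({\rm in}_\prec(I),N)$ is the ideal generated by ${\rm in}_\prec(I)\cup N$. For an ideal $J\subset S$, let $H_J^a(d)=\dim_K(S_{\leq d}/J_{\leq d})$, where $S_{\leq d}$, $J_{\leq d}$ are the polynomials of degree at most $d$ in $S$, $J$. If $J\subsetneq S$ and $k=\dim(S/J)$ (Krull dimension), then for $d\gg0$ $H_J^a(d)$ is a polynomial in $d$ of degree $k$ with leading coefficient $a_k$, and the degree is $\deg(S/J)=k!\,a_k$; $\deg(S/J)=0$ if $J=S$. In particular, if $k=0$, then $\deg(S/J)=\dim_K(S/J)$. For a linear code $C\subset K^m$ and $1\leq r\leq\dim_K C$, the $r$-th generalized Hamming weight is $\delta_r(C)=\min\{|\chi(D)| : D \text{ a linear subspace of } C,\ \dim_K D=r\}$, where $\chi(D)=\{i : \exists\,(a_1,\ldots,a_m)\in D,\ a_i\neq 0\}$. *)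

(* Defs.v *)
From HB Require Import structures.
From mathcomp Require Import all_boot all_order all_algebra finmap.
From mathcomp Require Import boolp classical_sets.
From mathcomp Require Import ring_quotient mpoly.

Set Implicit Arguments.
Unset Strict Implicit.
Unset Printing Implicit Defensive.

Import Order.TTheory GRing.Theory Num.Theory.

Local Open Scope classical_set_scope.
Local Open Scope ring_scope.

(* [setmax x0 A] and [setmin x0 A] are the greatest and least elements of A,
   with the default x0 when there is none. *)
Definition setmax d (T : porderType d) (x0 : T) (A : set T) : T :=
  xget x0 (A `&` ubound A).
Definition setmin d (T : porderType d) (x0 : T) (A : set T) : T :=
  xget x0 (A `&` lbound A).

Section Algebra.
Variables (K : fieldType) (n : nat).
Local Notation S := {mpoly K[n]}.
Implicit Types (G J V W : {pred S}) (f : S).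

Definition ideal_gen G : {pred S} :=
  [pred f | `[< exists (k : nat) (a g : 'I_k -> S),
                  (forall i, g i \in G) /\ f = \sum_(i < k) a i * g i >]].

Definition lin_span G : {pred S} :=
  [pred f | `[< exists (k : nat) (c : 'I_k -> K) (g : 'I_k -> S),
                  (forall i, g i \in G) /\ f = \sum_(i < k) c i *: g i >]].

(* dim_K (V / W), as the cardinality k of a family b in V whose classes modulo
   W form a basis of V / W. *)
Definition quotient_dim V W : nat :=
  xget 0%N [set k : nat | exists b : 'I_k -> S,
    (forall i, b i \in V) /\
    (forall f, f \in V ->
       exists! c : {ffun 'I_k -> K}, f - \sum_(i < k) c i *: b i \in W)].

(* [msize f] is one more than the total degree of f, and [msize 0 = 0]. *)
Definition deg_le J (d : nat) : {pred S} :=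
  [pred f | (f \in J) && (msize f <= d.+1)%N].

Definition hilbert_fun J (d : nat) : nat :=
  quotient_dim (deg_le predT d) (deg_le J d).

(* [idealr_closed] includes properness. *)
Definition prime_ideal J : Prop := idealr_closed J /\ prime_idealr_closed J.

(* Krull dimension of S / J; prime ideals of S / J are handled as prime ideals
   of S containing J. *)
Definition krull_dim J : nat :=
  setmax 0%N [set k : nat | exists p : nat -> {pred S},
    (forall i, (i <= k)%N -> prime_ideal (p i) /\ {subset J <= p i}) /\
    (forall i, (i < k)%N ->
       {subset p i <= p i.+1} /\ ~ {subset p i.+1 <= p i})].

(* deg (S / J) = k! a_k, where k = dim (S / J) and a_k is the coefficient of
   degree k of the polynomial agreeing with the affine Hilbert function of J in
   all large degrees. *)
Definition degree J : rat :=
  if `[< forall f, f \in J >] then 0 else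
  xget 0 [set e : rat | exists (h : {poly rat}) (d0 : nat),
    (forall d, (d0 <= d)%N -> (hilbert_fun J d)%:R = h.[d%:R]) /\
    e = (krull_dim J)`!%:R * h`_(krull_dim J)].

End Algebra.

(* [ord m1 m2] stands for m1 <= m2 in the order; the product of monomials is
   the sum of exponents, and [0%MM] is the monomial 1. *)
Definition monomial_order n (ord : rel 'X_{1..n}) : Prop :=
  [/\ reflexive ord, antisymmetric ord, transitive ord & total ord] /\
  (forall m, ord 0%MM m) /\
  (forall m m1 m2, ord m1 m2 -> ord (m + m1)%MM (m + m2)%MM).

Section Initial.
Variables (K : fieldType) (n : nat) (ord : rel 'X_{1..n}).
Local Notation S := {mpoly K[n]}.
Implicit Types (J L : {pred S}) (f : S).

(* The default 0%MM is the least monomial, so that for f != 0 this is the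
   greatest monomial of the support of f. *)
Definition initial_mon f : 'X_{1..n} :=
  \big[(fun m1 m2 => if ord m1 m2 then m2 else m1) / 0%MM]_(m <- msupp f) m.

(* in(L^* ), for an arbitrary set L of polynomials *)
Definition initial_mons L : {pred 'X_{1..n}} :=
  [pred m | `[< exists f, [/\ f \in L, f != 0 & m = initial_mon f] >]].

Definition monomials (M : {pred 'X_{1..n}}) : {pred S} :=
  [pred g | `[< exists2 m, m \in M & g = 'X_[m] >]].

Definition initial_ideal J : {pred S} := ideal_gen (monomials (initial_mons J)).

Definition std_monomials J : {pred 'X_{1..n}} :=
  [pred m | 'X_[m] \notin initial_ideal J].

Definition std_span J : {pred S} := lin_span (monomials (std_monomials J)).

(* the ideal (in(J), N) *)
Definition initial_ideal_add J (N : {fset 'X_{1..n}}) : {pred S} :=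
  ideal_gen [predU initial_ideal J & monomials (mem N)].

End Initial.

Section Codes.
Variables (K : finFieldType) (s : nat).
Local Notation S := {mpoly K[s]}.
Implicit Types (X : {set 'rV[K]_s}) (L : {pred S}).

Definition vanishing_ideal X : {pred S} :=
  [pred f : S | [forall P in X, f.@[P 0] == 0]].

Definition ev X (f : S) : 'rV[K]_#|X| := \row_(i < #|X|) f.@[enum_val i 0].

(* For a linear subspace L, the span adds nothing to the image ev(L): see
   [mem_eval_code]. *)
Definition eval_code X L : {vspace 'rV[K]_#|X|} :=
  <<[seq v <- enum 'rV[K]_#|X| | `[< exists2 f, f \in L & v = ev X f >]]>>%VS.

Lemma mem_eval_code X L (v : 'rV[K]_#|X|) : submod_closed L ->
  v \in eval_code X L <-> exists2 f, f \in L & v = ev X f.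
Proof.
move=> [L0 Llin]; split; last first.
  move=> Lv; apply: memv_span; rewrite mem_filter mem_enum andbT.
  exact/asboolP.
have evlin a f g : ev X (a *: f + g) = a *: ev X f + ev X g.
  by apply/rowP => i; rewrite !mxE mevalD mevalZ.
rewrite /eval_code; set B := filter _ _ => vB.
rewrite (@coord_span _ _ _ (in_tuple B) _ vB).
apply: (big_ind (fun u => exists2 f, f \in L & u = ev X f)).
- by exists 0 => //; apply/rowP => i; rewrite !mxE meval0.
- move=> _ _ [f Lf ->] [g Lg ->]; exists (1 *: f + g); first exact: Llin.
  by rewrite evlin scale1r.
- move=> i _.
  have /(mem_nth 0) : (i < size B)%N by [].
  rewrite mem_filter => /andP[/asboolP[f Lf Bi] _].
  exists (coord (in_tuple B) i v *: f + 0); first exact: Llin.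
  rewrite evlin -Bi; apply/rowP => j.
  by rewrite !mxE meval0 addr0.
Qed.

Definition supp m (D : {vspace 'rV[K]_m}) : {set 'I_m} :=
  [set i | [exists a : 'rV[K]_m, (a \in D) && (a 0 i != 0)]].

Definition gen_hamming_weight m (C : {vspace 'rV[K]_m}) (r : nat) : nat :=
  setmin 0%N [set w : nat | exists D : {vspace 'rV[K]_m},
    [/\ (D <= C)%VS, \dim D = r & w = #|supp D|]].

(* fp_r(L_X); rational-valued since [degree] is. *)
Definition footprint (ord : rel 'X_{1..s}) X L (r : nat) : rat :=
  let I := vanishing_ideal X in
  degree I -
  setmax 0 [set e : rat | exists N : {fset 'X_{1..s}},
    [/\ {subset N <= initial_mons ord L}, #|` N| = r
      & e = degree (initial_ideal_add ord I N)]].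

End Codes.

(* Main.v *)
(* Let Y be the set of common zeros in X of a subspace D of the code, so that
   |Y| = |X| - |supp D|. Evaluation is injective on L because a nonzero standard
   polynomial cannot vanish on X; lifting D to L and taking initial monomials
   gives a set N of dim D monomials, since polynomials of the lift which agree
   at the coefficients in N have a difference with no initial monomial. As
   (in I(X), N) is contained in in I(Y), its degree, which is its number of
   standard monomials, is at least the number |Y| of standard monomials of I(Y).
   Every ideal involved contains I(X) or its initial ideal, hence x^q - x or x^q
   for each variable x; this gives finiteness and dimension zero directly, and
   over the finite field K dimensions can be compared by counting. *)
Require Import Defs.
From mathcomp Require Import all_boot all_order all_algebra finmap.
From mathcomp Require Import boolp classical_sets finfield mpoly.

Import Order.TTheory GRing.Theory Num.Theory.

Local Open Scope ring_scope.

(** * Quotient dimensions, Krull dimension and degree *)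

Section Degree.
Set Implicit Arguments.
Unset Strict Implicit.
Variables (K : finFieldType) (n : nat).
Local Notation S := {mpoly K[n]}.
Implicit Types (J V W : {pred S}) (f : S).

(** The functionals [phi] identify V / W with K^T, [b] being the dual family. Any other basis, of
    size k, gives a bijection from K^k to K^T, and counting over the finite field forces k =
    [#|T|]. *)
Lemma quotient_dim_dual (T : finType) (phi : T -> {scalar S}) (b : T -> S) V W :
  submod_closed V -> (forall t, b t \in V) ->
  (forall t u, phi t (b u) = (t == u)%:R) ->
  (forall f, f \in V -> (f \in W) = [forall t, phi t f == 0]) ->
  quotient_dim V W = #|T|.
Proof.
move=> [V0 Vlin] bV phib WE.
have Vsum k (c : 'I_k -> K) (v : 'I_k -> S) :
    (forall i, v i \in V) -> \sum_(i < k) c i *: v i \in V.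
  move=> vV; apply: (big_ind (fun u => u \in V)) => // [u w uV wV|i _].
    by rewrite -[u]scale1r Vlin.
  by rewrite -[_ *: _]addr0 Vlin.
have VB u w : u \in V -> w \in V -> u - w \in V.
  by move=> uV wV; rewrite addrC -scaleN1r Vlin.
have Wphi f g : f \in V -> g \in V ->
    (f - g \in W) <-> (forall t, phi t f = phi t g).
  move=> fV gV; rewrite WE; last exact: VB.
  split=> [/forallP E t|E].
    by apply/eqP; rewrite -subr_eq0 -linearB; apply: E.
  by apply/forallP => t; rewrite linearB /= E subrr.
have phiS (k : nat) (c : 'I_k -> K) (v : 'I_k -> S) t :
    phi t (\sum_(i < k) c i *: v i) = \sum_(i < k) c i * phi t (v i).
  by rewrite linear_sum; apply: eq_bigr => i _; rewrite linearZ.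
have phie (c : 'I_#|T| -> K) t :
    phi t (\sum_(i < #|T|) c i *: b (enum_val i)) = c (enum_rank t).
  rewrite phiS (bigD1 (enum_rank t)) //= enum_rankK phib eqxx mulr1 big1 ?addr0 //.
  move=> i it; rewrite phib; case: eqP => [tE|]; last by rewrite mulr0.
  by rewrite tE enum_valK eqxx in it.
apply: xget_unique.
  exists (fun i => b (enum_val i)); split=> // f fV.
  exists [ffun i => phi (enum_val i) f]; split.
    apply/Wphi => //; first exact: Vsum.
    by move=> t; rewrite phie ffunE enum_rankK.
  move=> c /Wphi E; apply/ffunP => i; rewrite ffunE E //; last exact: Vsum.
  by rewrite phie enum_valK.
move=> k [v [vV vU]].
pose F (c : {ffun 'I_k -> K}) : {ffun T -> K} :=
  [ffun t => phi t (\sum_(i < k) c i *: v i)].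
have Finj : injective F.
  move=> c d /ffunP E; have cV := Vsum _ c v vV.
  have [e [_ eU]] := vU _ cV.
  have <- : e = c by apply: eU; apply/Wphi.
  apply: eU; apply/Wphi => //; first exact: Vsum.
  by move=> t; have := E t; rewrite !ffunE.
have Fsurj (g : {ffun T -> K}) : exists c, F c == g.
  have gV : \sum_(i < #|T|) g (enum_val i) *: b (enum_val i) \in V by exact: Vsum.
  have [c [/Wphi E _]] := vU _ gV; exists c; apply/eqP/ffunP => t.
  by rewrite ffunE -E ?phie ?enum_rankK //; apply: Vsum.
pose G g := xchoose (Fsurj g).
have GK : cancel G F by move=> g; apply/eqP; exact: (xchooseP (Fsurj g)).
have : #|{ffun 'I_k -> K}| = #|{ffun T -> K}|.
  by apply: bij_eq_card; exists G => // c; apply: Finj; rewrite GK.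
rewrite !card_ffun card_ord => /eqP; rewrite eqn_exp2l ?finNzRing_gt1 //.
by move=> /eqP.
Qed.

(** A chain of positive length would start with a strict inclusion; if no prime contains [J],
    [setmax] takes its default 0. *)
Lemma krull_dim_eq0 J :
  (forall p p', prime_ideal p -> prime_ideal p' -> {subset J <= p} ->
     {subset p <= p'} -> {subset p' <= p}) ->
  krull_dim J = 0%N.
Proof.
move=> pmax; rewrite /krull_dim /setmax; case: xgetP => // k _ [[p [pP plt]] _].
case: k pP plt => // k pP /(_ 0%N isT) [p01 []].
by have [? ?] := pP 0%N isT; have [? ?] := pP 1%N isT; apply: pmax.
Qed.

(** A polynomial that takes the value [N] at infinitely many points is constant; the second
    hypothesis matches the convention that the unit ideal has degree 0. *)
Lemma degree_const J N d0 : krull_dim J = 0%N ->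
  ((forall f, f \in J) -> N = 0%N) ->
  (forall d, (d0 <= d)%N -> hilbert_fun J d = N) -> degree J = N%:R.
Proof.
move=> kJ JN HN; rewrite /degree kJ; case: asboolP => [/JN -> //|_].
apply: xget_unique.
  exists N%:R%:P, d0; split; first by move=> d /HN ->; rewrite hornerC.
  by rewrite coefC fact0 mul1r.
move=> _ [h [d1 [hE ->]]]; suff -> : h = N%:R%:P by rewrite coefC fact0 mul1r.
apply/eqP; rewrite -subr_eq0; apply: contraT => h0.
(* One root of h - N more than its degree allows, all beyond both thresholds. *)
pose rs : seq rat := [seq (d0 + d1 + i)%:R | i <- iota 0 (size (h - N%:R%:P))].
suff : (size rs < size (h - N%:R%:P)%R)%N by rewrite size_map size_iota ltnn.
apply: max_poly_roots => //.
  apply/allP => _ /mapP [i _ ->]; rewrite rootE !hornerE -hE.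
    by rewrite HN ?subrr // -addnA leq_addr.
  by rewrite addnAC leq_addl.
rewrite map_inj_uniq ?iota_uniq // => i j /eqP.
by rewrite eqr_nat eqn_add2l => /eqP.
Qed.

Lemma submod_closed_deg_le d : submod_closed (deg_le (predT : {pred S}) d).
Proof.
split; first by rewrite !inE msize0.
move=> a u v; rewrite !inE /= => ud vd.
rewrite (leq_trans (msizeD_le _ _)) // geq_max vd andbT.
exact: leq_trans (msizeZ_le _ _) ud.
Qed.

(** Once d bounds the degrees of all [b t], these polynomials lie in the degree-d part of the
    filtration and the Hilbert function is [#|T|]. *)
Lemma degree_dual (T : finType) (phi : T -> {scalar S}) (b : T -> S) J :
  krull_dim J = 0%N ->
  (forall t u, phi t (b u) = (t == u)%:R) ->
  (forall f, (f \in J) = [forall t, phi t f == 0]) ->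
  degree J = #|T|%:R.
Proof.
move=> kJ phib JE; apply: (@degree_const _ _ (\max_t msize (b t))) => //.
  move=> Jall; apply: eq_card0 => t; have := Jall (b t); rewrite JE.
  by move=> /forallP /(_ t); rewrite phib eqxx oner_eq0.
move=> d dge; apply: (quotient_dim_dual _ _ phib).
  exact: submod_closed_deg_le.
  move=> t; rewrite !inE /= (leq_trans _ (leqnSn d)) // (leq_trans _ dge) //.
  exact: (@leq_bigmax _ (fun t => msize (b t))).
by move=> f; rewrite !inE /= => fd; rewrite fd andbT -JE.
Qed.

End Degree.

(** * Monomial ideals and their standard monomials *)

Section MonomialIdeals.
Set Implicit Arguments.
Unset Strict Implicit.
Variables (K : finFieldType) (n : nat).
Local Notation S := {mpoly K[n]}.
Implicit Types (G J : {pred S}) (f g : S) (m : 'X_{1..n}).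

(** Unlike [idealr_closed], this admits the unit ideal, which (in(I), N) can be. *)
Definition ideal_closed J : Prop :=
  0 \in J /\ forall a, {in J &, forall u v, a * u + v \in J}.

(** For an ideal, this is the property of being generated by monomials. *)
Definition monomial_closed J : Prop :=
  forall f, (f \in J) = all (fun m => 'X_[m] \in J) (msupp f).

Lemma ideal_closedM J a u : ideal_closed J -> u \in J -> a * u \in J.
Proof. by move=> [J0 Jlin] uJ; rewrite -[_ * _]addr0 Jlin. Qed.

Lemma ideal_closed_sum J (I : eqType) (r : seq I) (F : I -> S) :
  ideal_closed J -> (forall i, i \in r -> F i \in J) -> \sum_(i <- r) F i \in J.
Proof.
move=> [J0 Jlin] FJ; rewrite big_seq; apply: (big_ind (fun u => u \in J)) => //.
by move=> u v uJ vJ; rewrite -[u]mul1r Jlin.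
Qed.

Lemma mem_ideal_gen G g : g \in G -> g \in ideal_gen G.
Proof.
move=> gG; apply/asboolP; exists 1%N, (fun=> 1), (fun=> g).
by rewrite big_ord1 mul1r.
Qed.

Lemma ideal_gen_closed G : ideal_closed (ideal_gen G).
Proof.
split.
  apply/asboolP; exists 0%N, (fun=> 0), (fun=> 0).
  by rewrite big_ord0; split=> // -[].
move=> a _ _ /asboolP [k [c [g [gG ->]]]] /asboolP [l [d [h [hG ->]]]].
apply/asboolP; exists (k + l)%N.
exists (fun i => match split i with inl j => a * c j | inr j => d j end).
exists (fun i => match split i with inl j => g j | inr j => h j end).
split; first by move=> i; case: splitP => j _.
rewrite big_split_ord /= mulr_sumr; congr (_ + _); apply: eq_bigr => i _.
  case: splitP => j /= ij; first by rewrite mulrA (val_inj ij : i = j).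
  by move: (ltn_ord i); rewrite ij ltnNge leq_addr.
case: splitP => j /= ij; last by move/addnI: ij => /val_inj ->.
by move: (ltn_ord j); rewrite -ij ltnNge leq_addr.
Qed.

Lemma ideal_gen_min G J :
  ideal_closed J -> {subset G <= J} -> {subset ideal_gen G <= J}.
Proof.
move=> Jid GJ _ /asboolP [k [c [g [gG ->]]]].
by apply: ideal_closed_sum => // i _; apply: ideal_closedM => //; apply: GJ.
Qed.

(** Every monomial of a product a g is a multiple of a monomial of g, so it suffices to look at the
    generators. *)
Lemma monomial_closed_gen G :
  (forall g m, g \in G -> m \in msupp g -> 'X_[m] \in ideal_gen G) ->
  monomial_closed (ideal_gen G).
Proof.
move=> GX f; apply/idP/allP => [/asboolP [k [a [g [gG ->]]]] m|fX].
  move=> /msupp_sum_le; rewrite filter_predT => /flatten_mapP [i _].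
  move=> /msuppM_le /allpairsP [[m1 m2] /= [_ m2g ->]].
  rewrite mpolyXD; apply/ideal_closedM/(GX _ _ (gG i)) => //.
  exact: ideal_gen_closed.
rewrite [f]mpolyE; apply: ideal_closed_sum => [|m mf].
  exact: ideal_gen_closed.
by rewrite -mul_mpolyC; apply/ideal_closedM/fX => //; apply: ideal_gen_closed.
Qed.

Lemma monomial_closed_initial (ord : rel 'X_{1..n}) J :
  monomial_closed (initial_ideal ord J).
Proof.
apply: monomial_closed_gen => g m gG mg; apply: mem_ideal_gen.
move: gG mg => /asboolP [m' ? ->]; rewrite msuppX inE => /eqP ->.
by apply/asboolP; exists m'.
Qed.

Lemma initial_ideal_sub_add (ord : rel 'X_{1..n}) J N :
  {subset initial_ideal ord J <= initial_ideal_add ord J N}.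
Proof. by move=> f fI; apply: mem_ideal_gen; apply/orP; left. Qed.

Lemma monomial_closed_initial_add (ord : rel 'X_{1..n}) J N :
  monomial_closed (initial_ideal_add ord J N).
Proof.
apply: monomial_closed_gen => g m gG mg; apply: mem_ideal_gen.
case/orP: gG => gG; apply/orP; [left|right]; move: gG mg.
  by rewrite monomial_closed_initial => /allP; apply.
move=> /asboolP [m' ? ->]; rewrite msuppX inE => /eqP ->.
by apply/asboolP; exists m'.
Qed.

Lemma prime_ideal_exp p f k : prime_ideal p -> f ^+ k \in p -> f \in p.
Proof.
move=> [[p0 p1 plin] pprime]; elim: k => [|k IHk].
  by rewrite expr0 (negPf p1).
by rewrite exprS => /pprime /orP [|/IHk].
Qed.

Lemma prime_ideal_closed p : prime_ideal p -> ideal_closed p.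
Proof. by move=> [[p0 p1 plin] _]. Qed.

(* A prime ideal containing a power of every variable is the maximal ideal of
   the origin. *)
Lemma krull_dim_powers J k :
  (forall i, 'X_i ^+ k \in J) -> krull_dim J = 0%N.
Proof.
move=> JX; apply: krull_dim_eq0 => p p' pP p'P Jp pp' f fp'.
have pX i : 'X_i \in p by apply: (@prime_ideal_exp _ _ k) => //; apply/Jp/JX.
have pid := prime_ideal_closed pP; have p'id := prime_ideal_closed p'P.
(* Each monomial left after removing the constant term is divisible by a variable. *)
have gp : f - (f@_0)%:MP \in p.
  rewrite [_ - _]mpolyE; apply: ideal_closed_sum => // m mg.
  rewrite -mul_mpolyC; apply: ideal_closedM => //.
  have [i mi] : exists i, (0 < m i)%N.
    apply/existsP; apply: contraT => /existsPn m0.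
    have m0' : m = 0%MM.
      by apply/mnmP => i; rewrite mnm0E; apply/eqP; rewrite -leqn0 leqNgt m0.
    by move: mg; rewrite m0' mcoeff_msupp mcoeffB mcoeffC eqxx mulr1 subrr eqxx.
  have -> : m = (m - U_(i) + U_(i))%MM.
    by rewrite submK //; apply/mnm_lepP => j; rewrite mnm1E; case: eqP => // <-.
  by rewrite mpolyXD; apply: ideal_closedM.
(* A nonzero constant term of [f] would be a unit in [p']. *)
have [f0|f0] := eqVneq f@_0 0; first by move: gp; rewrite f0 mpolyC0 subr0.
have [[_ p'1 _] _] := p'P; case/negP: p'1.
have -> : 1 = (f@_0)^-1%:MP * (-1 * (f - (f@_0)%:MP) + f).
  by rewrite mulN1r opprB subrK -mpolyCM mulVf.
by apply: ideal_closedM => //; apply: p'id.2 => //; apply: pp'.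
Qed.

Lemma large_mdeg m k : (n * k < mdeg m)%N -> exists i, (k <= m i)%N.
Proof.
move=> mk; apply/existsP; apply: contraTT mk => /existsPn mk.
rewrite -leqNgt mdegE -[n in (n * _)%N]card_ord -sum_nat_const leq_sum // => i _.
by apply: ltnW; rewrite ltnNge mk.
Qed.

(* The standard monomials of [J], when [J] contains the [#|K|]-th power of every
   variable; the bound on the degree makes this a finite set. *)
Definition std_box J : {set 'X_{1..n < (n * #|K|).+1}} :=
  [set m : 'X_{1..n < (n * #|K|).+1} | 'X_[m] \notin J].

(** The coefficients at the standard monomials are dual to these monomials. A monomial outside the
    box has an exponent of at least [#|K|], hence lies in [J]. *)
Lemma degree_monomial J :
  ideal_closed J -> monomial_closed J -> (forall i, 'X_i ^+ #|K| \in J) ->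
  degree J = #|std_box J|%:R.
Proof.
move=> Jid Jmon JX; rewrite -card_sig.
pose phi (t : {m | m \in std_box J}) : {scalar S} := mcoeff (bmnm (val t)).
pose b (t : {m | m \in std_box J}) : S := 'X_[val t].
apply: (@degree_dual _ _ _ phi b) => [|t u|f]; first exact: krull_dim_powers JX.
  by rewrite /phi /b /= mcoeffX -bmeqP eq_sym.
rewrite Jmon; apply/allP/forallP => [fJ t|f0 m mf].
  apply: contraTT (valP t); rewrite /phi /= -mcoeff_msupp => /fJ.
  by rewrite inE negbK.
apply: contraT => mJ; have [md|/large_mdeg [i mi]] := leqP (mdeg m) (n * #|K|).
  have mbox : BMultinom (md : (mdeg m < _.+1)%N) \in std_box J by rewrite inE.
  have := f0 (exist (fun t => is_true (t \in std_box J)) _ mbox).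
  by rewrite mcoeff_eq0 mf.
case/negP: mJ; rewrite -(@submK _ (U_(i) *+ #|K|)%MM m).
  by rewrite mpolyXD -mpolyXn; apply: ideal_closedM.
by apply/mnm_lepP => j; rewrite mulmnE mnm1E; case: eqP => [<-|]; rewrite ?mul1n.
Qed.

End MonomialIdeals.

(** * Initial ideals of vanishing ideals over a finite field *)

Section Standard.
Set Implicit Arguments.
Unset Strict Implicit.
Variables (K : finFieldType) (n : nat) (ord : rel 'X_{1..n}).
Hypothesis ordP : monomial_order ord.
Local Notation S := {mpoly K[n]}.
Implicit Types (X : {set 'rV[K]_n}) (J : {pred S}) (f : S) (m : 'X_{1..n}).

Lemma initial_monP f : f != 0 ->
  initial_mon ord f \in msupp f /\
  {in msupp f, forall m, ord m (initial_mon ord f)}.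
Proof.
have [[orefl oanti otrans ototal] [o0 _]] := ordP.
rewrite -msupp_eq0 /initial_mon; elim: (msupp f) => //= m s IHs _.
rewrite big_cons; set M := \big[_/_]_(_ <- s) _ in IHs *.
(* On an empty tail the fold returns [0%MM], which need not be in the support but is the least
   monomial. *)
have [sM Mub] : (M \in s \/ s = [::]) /\ {in s, forall m, ord m M}.
  case: (s) @M IHs => [|m' s'] M IHs; first by split; [right|].
  by have [] := IHs isT; split; [left|].
case: ifPn => mM; last first.
  split=> [|m']; first exact: mem_head.
  rewrite inE => /predU1P [-> //|/Mub m'M]; apply: otrans m'M _.
  by have := ototal m M; rewrite (negPf mM).
split; last by move=> m'; rewrite inE => /predU1P [-> //|/Mub].
rewrite inE; case: sM => [->|s0]; first by rewrite orbT.
move: mM; rewrite /M s0 big_nil => mM.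
by rewrite [0%MM](@oanti _ m) ?eqxx // o0.
Qed.

Lemma initial_monE f m : m \in msupp f ->
  {in msupp f, forall m', ord m' m} -> initial_mon ord f = m.
Proof.
have [[_ oanti _ _] _] := ordP.
move=> mf mub; have [|imf imub] := @initial_monP f.
  by apply: contraTneq mf => ->; rewrite msupp0.
by apply: oanti; rewrite mub ?imub.
Qed.

Lemma ord_lem m m' : (m <= m')%MM -> ord m m'.
Proof.
have [_ [o0 oadd]] := ordP; move=> mm'.
by rewrite -(submK mm') addmC -[X in ord X _]addm0; apply: oadd.
Qed.

Lemma mem_vanishing X f :
  reflect {in X, forall P : 'rV[K]_n, f.@[P 0] = 0} (f \in vanishing_ideal X).
Proof. by apply: (iffP 'forall_in_eqP). Qed.

(** With q = [#|K|], x^q - x vanishes on all of K^n, and its initial monomial is x^q because q > 1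
    makes x a proper divisor. *)
Lemma initial_ideal_powers X i :
  'X_i ^+ #|K| \in initial_ideal ord (vanishing_ideal X).
Proof.
have q1 := finNzRing_gt1 K.
apply: mem_ideal_gen; apply/asboolP; exists (U_(i) *+ #|K|)%MM; last first.
  by rewrite mpolyXn.
have neq : U_(i)%MM != (U_(i) *+ #|K|)%MM.
  apply/eqP => /mnmP /(_ i); rewrite mulmnE mnm1E eqxx mul1n => q1'.
  by rewrite -q1' in q1.
have qf : (U_(i) *+ #|K|)%MM \in msupp ('X_i ^+ #|K| - 'X_i : S).
  by rewrite mcoeff_msupp mcoeffB mpolyXn !mcoeffX eqxx (negPf neq) subr0 oner_eq0.
apply/asboolP; exists ('X_i ^+ #|K| - 'X_i); split.
- by apply/mem_vanishing => P _; rewrite mevalB rmorphXn /= mevalXU expf_card subrr.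
- by apply: contraTneq qf => ->; rewrite msupp0.
symmetry; apply: initial_monE => // m /msuppB_le.
rewrite mpolyXn mem_cat !msuppX !inE.
have [[orefl _ _ _] _] := ordP.
case/orP => /eqP -> //; apply/ord_lem/mnm_lepP => j.
by rewrite mulmnE leq_pmulr // ltnW.
Qed.

(** As x^(q-1) = 1 for nonzero x, a factor vanishes exactly where the i-th coordinate differs from
    that of [P]. *)
Definition point_indicator (P : 'rV[K]_n) : S :=
  \prod_i (1 - ('X_i - (P 0 i)%:MP) ^+ #|K|.-1).

Lemma meval_indicator (P Q : 'rV[K]_n) : (point_indicator P).@[Q 0] = (Q == P)%:R.
Proof.
have q1 := finNzRing_gt1 K.
have ev i : (1 - ('X_i - (P 0 i)%:MP) ^+ #|K|.-1).@[Q 0] = (Q 0 i == P 0 i)%:R.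
  rewrite mevalB meval1 rmorphXn /= mevalB mevalXU mevalC -subr_eq0.
  have [->|x0] := eqVneq (Q 0 i - P 0 i) 0.
    by rewrite expr0n; case: #|K| q1 => [|[]] // k _; rewrite subr0.
  apply/eqP; rewrite subr_eq0 eq_sym; apply/eqP/(mulfI x0).
  by rewrite -exprS prednK ?expf_card ?mulr1 // ltnW.
rewrite rmorph_prod /=; under eq_bigr do rewrite ev.
have [->|QP] := eqVneq Q P; first by rewrite big1 // => i _; rewrite eqxx.
have [i Qi] : exists i, Q 0 i != P 0 i.
  apply/existsP; apply: contraNT QP => /existsPn QP; apply/eqP; apply/rowP => i.
  by apply/eqP; have := QP i; rewrite negbK.
by rewrite (bigD1 i) //= (negPf Qi) mul0r.
Qed.

(* Every [f] satisfies [f ^ q = f] modulo [vanishing_ideal X], so the primes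
   above it are maximal. *)
Lemma krull_dim_vanishing X : krull_dim (vanishing_ideal X) = 0%N.
Proof.
have q1 := finNzRing_gt1 K.
apply: krull_dim_eq0 => p p' pP p'P Ip pp' f fp'.
have p'id := prime_ideal_closed p'P; have [[_ p'1 _] _] := p'P.
have : f * (f ^+ #|K|.-1 - 1) \in p.
  apply: Ip; apply/mem_vanishing => P _; rewrite mulrBr -exprS prednK ?(ltnW q1) //.
  by rewrite mulr1 mevalB rmorphXn /= expf_card subrr.
case: pP => _ pprime /pprime /orP [//|/pp' g'].
(* 1 is the difference of f^(q-1) and f^(q-1) - 1, both in [p']; the first is a multiple of f since
   q - 1 > 0. *)
case/negP: p'1; rewrite -[1](subKr (f ^+ #|K|.-1)) -mulN1r addrC.
apply: p'id.2 => //; case: #|K| q1 => [|[]] // k _ /=; rewrite exprSr.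
exact: ideal_closedM.
Qed.

(** Evaluations at the points of [X] are dual to the point indicators. *)
Lemma degree_vanishing X : degree (vanishing_ideal X) = #|X|%:R.
Proof.
rewrite -card_sig.
pose phi (t : {P | P \in X}) : {scalar S} := meval (val t 0).
pose b (t : {P | P \in X}) := point_indicator (val t).
apply: (@degree_dual _ _ _ phi b) => [|t u|f]; first exact: krull_dim_vanishing.
  by rewrite /phi /b /= meval_indicator.
apply/mem_vanishing/forallP => [f0 t|f0 P PX]; first by apply/eqP/f0/(valP t).
by apply/eqP; apply: (f0 (exist (fun P => is_true (P \in X)) P PX)).
Qed.

(** Replacing a factor x^q by x preserves the function on K^n, lowers the degree and does not go up
    in [ord]. It is possible as long as the degree exceeds n q, since some exponent then reaches
    q. *)
Lemma monomial_reduce m : exists m',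
  [/\ (mdeg m' <= n * #|K|)%N, ord m' m &
      forall v : 'I_n -> K, 'X_[m].@[v] = 'X_[m'].@[v]].
Proof.
have [[orefl _ otrans _] _] := ordP; have q1 := finNzRing_gt1 K.
have [k] := ubnP (mdeg m); elim: k m => // k IHk m mk.
have [md|/large_mdeg [i mi]] := leqP (mdeg m) (n * #|K|); first by exists m.
pose m1 := (m - U_(i) *+ #|K|)%MM.
have mE : m = (m1 + U_(i) *+ #|K|)%MM.
  rewrite submK //; apply/mnm_lepP => j; rewrite mulmnE mnm1E.
  by case: eqP => [<-|]; rewrite ?mul1n.
have [|m' [m'd m'm m'v]] := IHk (m1 + U_(i))%MM.
  rewrite -ltnS (leq_trans _ mk) // ltnS mE !mdegD mdegMn mdeg1 mul1n.
  by rewrite ltn_add2l.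
exists m'; split=> // [|v].
  apply: otrans m'm _; rewrite mE; apply/ord_lem/mnm_lepP => j.
  by rewrite !mnmDE mulmnE leq_add2l leq_pmulr // ltnW.
by rewrite -m'v mE !mpolyXD !mevalM -!mpolyXn !rmorphXn /= mevalXU expf_card.
Qed.

(* Dickson's lemma is avoided by first lowering monomials, with x ^ q = x, into
   a finite box, where the induction along [ord] takes place. *)
Lemma card_std_box X :
  (#|X| <= #|std_box (initial_ideal ord (vanishing_ideal X))|)%N.
Proof.
have [[orefl oanti otrans _] [_ oadd]] := ordP.
set D := std_box _.
(* It suffices that the evaluations of the standard monomials in the box span the whole space, of
   dimension [#|X|]. *)
pose U := <<[seq ev X 'X_[bmnm t] | t in D]>>%VS.
have evD f g : ev X (f + g) = ev X f + ev X g.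
  by apply/rowP => i; rewrite !mxE mevalD.
have evZ a f : ev X (a *: f) = a *: ev X f.
  by apply/rowP => i; rewrite !mxE mevalZ.
have evS (I : eqType) (r : seq I) (c : I -> K) (g : I -> S) :
    {in r, forall i, ev X (g i) \in U} -> ev X (\sum_(i <- r) c i *: g i) \in U.
  move=> gU; rewrite big_seq; apply: (big_ind (fun f => ev X f \in U)).
  - by have <- : 0 = ev X 0; [apply/rowP => i; rewrite !mxE meval0|exact: mem0v].
  - by move=> u v uU vU; rewrite evD memvD.
  - by move=> i ir; rewrite evZ memvZ // gU.
have red m : exists m' : 'X_{1..n < (n * #|K|).+1},
    ord m' m /\ ev X 'X_[m] = ev X 'X_[m'].
  have [m' [m'd m'm m'v]] := monomial_reduce m.
  exists (@BMultinom _ (n * #|K|).+1 m' m'd); split=> //.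
  by apply/rowP => i; rewrite !mxE.
(* The number of box monomials strictly below [m] is the induction measure. *)
pose below (m : 'X_{1..n < (n * #|K|).+1}) :=
  [set m' : 'X_{1..n < (n * #|K|).+1} | ord m' m & m' != m].
have evbox (m : 'X_{1..n < (n * #|K|).+1}) : ev X 'X_[m] \in U.
  have [k] := ubnP #|below m|; elim: k m => // k IHk m mk.
  have [mD|] := boolP (m \in D).
    by apply: memv_span; apply/fintype.imageP; exists m.
  rewrite inE negbK => /asboolP [l [a [g [gin mE]]]].
  have : (bmnm m) \in msupp (\sum_(i < l) a i * g i) by rewrite -mE msuppX inE.
  move=> /msupp_sum_le; rewrite filter_predT => /flatten_mapP [i _].
  move=> /msuppM_le /allpairsP [[m1 m2] /= [_ m2g mE']].
  have /asboolP [m3 /asboolP [f [fI f0 m3E]] gE] := gin i.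
  move: m2g; rewrite gE msuppX inE m3E => /eqP m2E; rewrite {m3 gE m3E}m2E in mE'.
  have [m2f m2ub] := initial_monP f0; set m2' := initial_mon ord f in mE' m2f m2ub.
  (* Here [m] is [m1] times the initial monomial of [f] in I(X). The product of [m1] and [f]
     evaluates to 0, so the evaluation of [m] is a combination of those of smaller monomials. *)
  have fE : 'X_[m1] * f = \sum_(m' <- msupp f) f@_m' *: 'X_[m1 + m'].
    rewrite {1}[f]mpolyE mulr_sumr; apply: eq_bigr => m' _.
    by rewrite -scalerAr mpolyXD.
  have ev0 : ev X ('X_[m1] * f) = 0.
    apply/rowP => j; rewrite !mxE mevalM.
    by have /mem_vanishing -> := fI; rewrite ?mulr0 // enum_valP.
  move: ev0; rewrite fE (bigD1_seq m2') ?msupp_uniq //= evD evZ -mE'.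
  move/eqP; rewrite addr_eq0 => /eqP lead.
  suff tail : ev X (\sum_(m' <- msupp f | m' != m2') f@_m' *: 'X_[m1 + m']) \in U.
    have c0 : f@_m2' != 0 by rewrite -mcoeff_msupp.
    by rewrite -[ev X _](scalerK c0) lead memvZ // rpredN.
  rewrite -big_filter; apply: evS => m'; rewrite mem_filter => /andP [m'2 m'f].
  (* A tail monomial may lie outside the box, so it is lowered into it before the induction
     hypothesis applies. *)
  have [m4 [om4 ->]] := red (m1 + m')%MM; apply: IHk.
  have om : ord (m1 + m')%MM m by rewrite mE'; apply/oadd/m2ub.
  have om4m : ord m4 m by apply: otrans om4 om.
  (* Otherwise m <= m4 <= m1 m' <= m, whence m' = m2', the term that was split off. *)
  have nm m5 : ord m5 m4 -> m5 != bmnm m.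
    apply: contraTneq => ->; apply/negP => om4'.
    case/negP: m'2; apply/eqP.
    have /eqP : (m1 + m')%MM = m by apply: oanti; rewrite om (otrans _ _ _ om4' om4).
    by rewrite mE' eqm_add2l => /eqP.
  rewrite -ltnS (leq_trans _ mk) // ltnS; apply: proper_card; apply/properP; split.
    apply/fintype.subsetP => m5; rewrite !inE => /andP [o5 _].
    by rewrite (otrans _ _ _ o5 om4m) bmeqP nm.
  exists m4; last by rewrite inE eqxx andbF.
  by rewrite inE om4m bmeqP nm.
have fullU : (fullv <= U)%VS.
  apply/subvP => v _.
  (* Interpolation by point indicators; their monomials are then lowered into the box. *)
  have -> : v = ev X (\sum_(j < #|X|) v 0 j *: point_indicator (enum_val j)).
    apply/rowP => i; rewrite mxE rmorph_sum /= (bigD1 i) //= big1 => [|j ji].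
      by rewrite mevalZ meval_indicator eqxx mulr1 addr0.
    by rewrite mevalZ meval_indicator (inj_eq enum_val_inj) eq_sym (negPf ji) mulr0.
  apply: (evS) => j _; rewrite [point_indicator _]mpolyE; apply: (evS) => m _.
  by have [m' [_ ->]] := red m.
have := leq_trans (dimvS fullU) (dim_span _).
by rewrite size_image dimvf /dim /= mul1n.
Qed.

End Standard.

(** * Attained minima and maxima *)

Section Extrema.
Set Implicit Arguments.
Unset Strict Implicit.

Lemma setmin_mem (A : set nat) : (exists k, A k) -> A (setmin 0%N A).
Proof.
move=> [k0 Ak0]; have exA : exists k, `[< A k >] by exists k0; apply/asboolP.
have : exists k, (A `&` lbound A)%classic k.
  case: (ex_minnP exA) => k /asboolP Ak kmin.
  by exists k; split=> // l Al; apply/kmin/asboolP.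
by move=> /(xgetPex 0%N) [].
Qed.

(** A nonempty set of natural numbers bounded by [B] has a greatest element, so [setmax] does not
    fall back on its default. *)
Lemma setmax_ge (R : realDomainType) (A : set R) (B : nat) e :
  (forall x, A x -> exists2 k, (k <= B)%N & x = k%:R) -> A e ->
  e <= setmax 0 A.
Proof.
move=> AB Ae.
have exA : exists k, `[< A k%:R >].
  by have [k _ ek] := AB e Ae; exists k; apply/asboolP; rewrite -ek.
have leB k : `[< A k%:R >] -> (k <= B)%N.
  by move=> /asboolP /AB [l lB /eqP]; rewrite eqr_nat => /eqP ->.
have : exists x, (A `&` ubound A)%classic x.
  case: (ex_maxnP exA leB) => k /asboolP Ak kmax.
  exists k%:R; split=> // x Ax; have [l _ xl] := AB x Ax.
  by rewrite xl ler_nat; apply/kmax/asboolP; rewrite -xl.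
by move=> /(xgetPex 0) [_ /(_ e Ae)].
Qed.

End Extrema.

(** * Lifting subcodes to polynomials and comparing degrees *)

Section Codes.
Set Implicit Arguments.
Unset Strict Implicit.

(** This makes the set of weights in [gen_hamming_weight] nonempty, so that its minimum is
    attained. *)
Lemma subspace_dim (F : fieldType) (V : vectType F) (C : {vspace V}) r :
  (r <= \dim C)%N -> exists2 D : {vspace V}, (D <= C)%VS & \dim D = r.
Proof.
move=> rC; exists <<take r (vbasis C)>>%VS.
  apply/span_subvP => v /mem_take; exact: vbasis_mem.
have : free (take r (vbasis C)).
  apply: (@catl_free _ _ (drop r (vbasis C))).
  by rewrite cat_take_drop (basis_free (vbasisP C)).
by rewrite /free => /eqP ->; rewrite size_takel // size_tuple.
Qed.

Variables (K : finFieldType) (s : nat) (ord : rel 'X_{1..s}).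
Hypothesis ordP : monomial_order ord.
Local Notation S := {mpoly K[s]}.
Implicit Types (X Y : {set 'rV[K]_s}) (L : {pred S}) (f : S).

(** If [f] were nonzero, its initial monomial would lie in in(I), yet it occurs in [f], whose
    monomials are all standard. *)
Lemma std_span_vanishing X f :
  f \in std_span ord (vanishing_ideal X) -> f \in vanishing_ideal X -> f = 0.
Proof.
move=> /asboolP [k [c [g [gstd fE]]]] fI; apply/eqP; apply: contraT => f0.
have [mf _] := initial_monP ordP f0.
have inI : 'X_[initial_mon ord f] \in initial_ideal ord (vanishing_ideal X).
  apply: mem_ideal_gen; apply/asboolP; exists (initial_mon ord f) => //.
  by apply/asboolP; exists f.
move: mf; rewrite {2}fE => /msupp_sum_le; rewrite filter_predT.
move=> /flatten_mapP [i _] /msuppZ_le; have /asboolP [m mstd ->] := gstd i.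
by rewrite msuppX inE => /eqP mE; move: mstd; rewrite inE -mE inI.
Qed.

(** The coefficients of the lifts at the set [M] of all their initial monomials embed [D] in K^M,
    and counting bounds [\dim D] by the size of [M]. *)
Lemma initial_mons_subspace X L (D : {vspace 'rV[K]_#|X|}) :
  submod_closed L -> {subset L <= std_span ord (vanishing_ideal X)} ->
  (D <= eval_code X L)%VS ->
  exists2 N : {fset 'X_{1..s}}, #|` N| = \dim D &
    forall m, m \in N ->
      exists f, [/\ f \in L, f != 0, ev X f \in D & m = initial_mon ord f].
Proof.
move=> Lsub Lstd DC; have [L0 Llin] := Lsub.
pose F v : S := xget 0 [set f | f \in L /\ ev X f = v]%classic.
have FP v : v \in D -> F v \in L /\ ev X (F v) = v.
  move=> vD; have /(mem_eval_code _ Lsub) [f fL vE] := subvP DC _ vD.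
  by apply: (@xgetPex _ 0 [set f | f \in L /\ ev X f = v]%classic); exists f.
have evB f g : ev X (f - g) = ev X f - ev X g.
  by apply/rowP => i; rewrite !mxE mevalB.
have LB f g : f \in L -> g \in L -> f - g \in L.
  by move=> fL gL; rewrite addrC -scaleN1r Llin.
have evinj f g : f \in L -> g \in L -> ev X f = ev X g -> f = g.
  move=> fL gL /eqP; rewrite -subr_eq0 -evB => /eqP /rowP E; apply/eqP.
  rewrite -subr_eq0; apply/eqP; apply: (@std_span_vanishing X); first exact/Lstd/LB.
  apply/mem_vanishing => P PX; have := E (enum_rank_in PX P).
  by rewrite !mxE enum_rankK_in.
have F0 v : v \in D -> v != 0 -> F v != 0.
  move=> vD; apply: contraNneq => Fv0; have [_ <-] := FP v vD.
  by apply/eqP/rowP => i; rewrite Fv0 !mxE meval0.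
pose ms := [seq initial_mon ord (F v) | v <- enum D & v != 0].
pose M : {fset 'X_{1..s}} := [fset m in ms]%fset.
pose G v : {ffun M -> K} := [ffun m => (F v)@_(val m)].
have Ginj : {in D &, injective G}.
  move=> v w vD wD /ffunP E; apply/eqP; rewrite -subr_eq0; apply: contraT => u0.
  have uD : v - w \in D by exact: memvB.
  have [vL ev_v] := FP v vD; have [wL ev_w] := FP w wD.
  have [uL ev_u] := FP _ uD.
  (* The lift is additive, so the lift of v - w would have coefficient 0 at its own initial
     monomial. *)
  have FB : F (v - w) = F v - F w.
    by apply: evinj => //; [exact: LB|rewrite evB ev_v ev_w].
  have [mu _] := initial_monP ordP (F0 _ uD u0); set m := initial_mon _ _ in mu.
  have mM : m \in M by rewrite inE; apply: map_f; rewrite mem_filter u0 mem_enum.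
  move: mu; have := E [` mM]%fset; rewrite !ffunE /= mcoeff_msupp FB mcoeffB => ->.
  by rewrite subrr eqxx.
have dimM : (\dim D <= #|` M|)%N.
  rewrite -(@leq_exp2l #|K|) ?finNzRing_gt1 // -card_vspace -(card_in_imset Ginj).
  by rewrite cardfE -card_ffun max_card.
(* Any [\dim D] elements of [M] will do. *)
exists [fset m in take (\dim D) M]%fset.
  by rewrite card_fseq undup_id ?take_uniq ?fset_uniq // size_takel.
move=> m; rewrite inE => /mem_take; rewrite inE => /mapP [v].
rewrite mem_filter mem_enum => /andP [v0 vD] ->.
by have [vL evv] := FP v vD; exists (F v); split=> //; [exact: F0|rewrite evv].
Qed.

Lemma initial_mons_sub (J J' : {pred S}) :
  {subset J <= J'} -> {subset initial_mons ord J <= initial_mons ord J'}.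
Proof.
move=> JJ' m /asboolP [f [fJ f0 mE]]; apply/asboolP; exists f.
by split=> //; apply: JJ'.
Qed.

Lemma degree_initial_add X N :
  degree (initial_ideal_add ord (vanishing_ideal X) N) =
  #|std_box (initial_ideal_add ord (vanishing_ideal X) N)|%:R.
Proof.
apply: degree_monomial; first exact: ideal_gen_closed.
  exact: monomial_closed_initial_add.
by move=> i; apply: initial_ideal_sub_add; apply: initial_ideal_powers.
Qed.

(** As I(X) is contained in I(Y), every standard monomial of I(Y) in the box is standard for the
    ideal with [N] added. *)
Lemma degree_initial_add_ge X Y N :
  Y \subset X -> {subset N <= initial_mons ord (vanishing_ideal Y)} ->
  #|Y|%:R <= degree (initial_ideal_add ord (vanishing_ideal X) N).
Proof.
move=> /fintype.subsetP YX NY; rewrite degree_initial_add ler_nat.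
apply: leq_trans (card_std_box ordP Y) _; apply/subset_leq_card/fintype.subsetP => m.
rewrite !finset.in_set; apply: contra; move: ('X_[m] : S).
apply: ideal_gen_min; first exact: ideal_gen_closed.
move=> g /orP [|/asboolP [m' m'N ->]]; last first.
  by apply: mem_ideal_gen; apply/asboolP; exists m' => //; apply: NY.
apply: ideal_gen_min; first exact: ideal_gen_closed.
move=> h /asboolP [m' m'I ->]; apply: mem_ideal_gen; apply/asboolP; exists m' => //.
apply: initial_mons_sub m'I => f /mem_vanishing f0; apply/mem_vanishing => P PY.
exact/f0/YX.
Qed.

End Codes.

(** * The footprint bound *)

Theorem theorem3p9 (K : finFieldType) (s : nat) (ord : rel 'X_{1..s})
    (X : {set 'rV[K]_s}) (L : {pred {mpoly K[s]}}) (r : nat) :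
  monomial_order ord ->
  submod_closed L ->
  {subset L <= std_span ord (vanishing_ideal X)} ->
  (1 <= r <= \dim (eval_code X L))%N ->
  footprint ord X L r <= (gen_hamming_weight (eval_code X L) r)%:R.
Proof.
move=> ordP Lsub Lstd /andP [_ rC].
have /setmin_mem [D [DC dimD wE]] :
    exists w : nat, exists D : {vspace 'rV[K]_#|X|},
    [/\ (D <= eval_code X L)%VS, \dim D = r & w = #|supp D|].
  by have [D DC dimD] := subspace_dim rC; exists #|supp D|, D.
rewrite /gen_hamming_weight wE.
have [N cardN NP] := initial_mons_subspace ordP Lsub Lstd DC.
pose Y := [set enum_val i | i in ~: supp D].
have YX : Y \subset X.
  by apply/fintype.subsetP => _ /imsetP [i _ ->]; apply: enum_valP.
have NY : {subset N <= initial_mons ord (vanishing_ideal Y)}.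
  move=> m /NP [f [_ f0 fD ->]]; apply/asboolP; exists f; split=> //.
  apply/mem_vanishing => _ /imsetP [i iD ->]; apply/eqP.
  move: iD; rewrite !inE; apply: contraNT => fi.
  by apply/existsP; exists (ev X f); rewrite fD mxE.
have cardY : (#|Y| = #|X| - #|supp D|)%N.
  rewrite (card_imset _ (@enum_val_inj _ _)).
  by rewrite -[LHS](addKn #|supp D|) cardsC [#|'I__|]card_ord.
have degN := degree_initial_add_ge ordP YX NY.
(* Since I(X) has degree |X|, the claim becomes |X| <= max + |supp D|. *)
rewrite /footprint degree_vanishing lerBlDl; set E := [set _ | _]%classic.
have : degree (initial_ideal_add ord (vanishing_ideal X) N) <= setmax 0 E.
  (* All competing degrees count subsets of one finite box, so the maximum exists. *)
  apply: (@setmax_ge _ _ #|{: 'X_{1..s < (s * #|K|).+1}}|).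
    move=> _ [N' [_ _ ->]].
    exists #|std_box (initial_ideal_add ord (vanishing_ideal X) N')|.
      exact: max_card.
    exact: degree_initial_add.
  exists N; split=> //; last by rewrite cardN.
  by move=> m /NP [f [fL f0 _ ->]]; apply/asboolP; exists f.
move=> /(le_trans degN) YE.
have suppX : (#|supp D| <= #|X|)%N by rewrite -[leqRHS]card_ord max_card.
have -> : #|X|%:R = #|Y|%:R + #|supp D|%:R :> rat by rewrite -natrD cardY subnK.
exact: lerD.
Qed.
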